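(* Let $n,M$ be positive integers, let $q_1,\dots,q_n\ge0$ be real numbers with $\sum_{j=1}^n q_j=M$, let $0\le\rho\le1$, and put $q_j^\rho=\frac{q_j}{M}(M+2\rho-1)$ for $1\le j\le n$. Let $$\psi(\mathbf m)=\sum_{j=1}^n|m_j-q_j^\rho| .$$ Then the $\rho$-rounding method can be obtained from the algorithm MinimalSolution for the decomposable error function $\psi$; that is, the set of seat vectors output by MinimalSolution for $\psi$ is equal to the set of seat vectors produced by the $\rho$-rounding method for the exact quotas $(q_1,\dots,q_n)$.
   Context: $\mathbb N=\{0,1,2,\dots\}$, and $\mathcal M=\{(m_1,\dots,m_n)\in\mathbb Z^n: m_j\ge0,\ \sum_j m_j=M\}$ is the set of possible allocations of $M$ seats to $n$ parties; $q_j$ is the exact quota of party $j$. Decomposable error function: a function $\psi:\mathcal M\to\mathbb R_{\ge0}$ of the form $\psi(\mathbf m)=\sum_{j=1}^n\varphi_j(m_j)$ with $\varphi_j:\mathbb N\to\mathbb R_{\ge0}$ such that $H_j(\ell)=\varphi_j(\ell)-\varphi_j(\ell-1)$, $\ell\ge1$, is (weakly) increasing in $\ell$ for each $j$. Here $\varphi_j(x)=|x-q_j^\rho|$. Algorithm MinimalSolution for $\psi$: it outputs the vectors $\mathbf m\in\mathcal M$ such that the multiset $\{H_j(\ell):1\le\ell\le m_j,\ 1\le j\le n\}$ is the multiset of the $M$ smallest entries, counted with multiplicity, of the $M\times n$ matrix with entry $H_j(\ell)$ in row $\ell$, column $j$ (several output vectors are possible in case of ties). $\rho$-rounding method: let $\mu_j^\rho=\lfloor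 q_j^\rho\rfloor$, $r_j^\rho=q_j^\rho-\mu_j^\rho$, and $R=M-\sum_{j=1}^n\mu_j^\rho$. One first allocates $\mu_j^\rho$ seats to party $j$. If $R\ge0$, the $R$ remaining seats are given, one each, to $R$ parties with the largest remainders $r_j^\rho$ (ties broken arbitrarily): $m_j=\mu_j^\rho+1$ for $j\in J$ and $m_j=\mu_j^\rho$ for $j\notin J$, where $J\subseteq\{1,\dots,n\}$, $|J|=R$, and $r_j^\rho\ge r_k^\rho$ for all $j\in J$, $k\notin J$. If $R=-1$ (which can only occur when $\rho=1$ and all $q_j^\rho$ are integers), one seat is taken away from one arbitrarily chosen party among those with $\mu_j^\rho>q_j$. The set of seat vectors produced by the method is the set of all $(m_1,\dots,m_n)$ arising from all possible arbitrary choices. *)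

(* Defs.v *)
From mathcomp Require Import all_boot all_order all_algebra.
From mathcomp Require Import boolp classical_sets reals.

Set Implicit Arguments.
Unset Strict Implicit.
Unset Printing Implicit Defensive.

Import Order.TTheory GRing.Theory Num.Theory.
Local Open Scope ring_scope.

Definition seat_vector (n : nat) := {ffun 'I_n -> nat}.

Definition allocations (n M : nat) : set (seat_vector n) :=
  [set m : seat_vector n | (\sum_(j < n) m j = M)%N]%classic.

(* H_j(l); only used for l >= 1. *)
Definition increment (R : realType) (n : nat) (phi : 'I_n -> nat -> R)
    (j : 'I_n) (l : nat) : R :=
  phi j l - phi j l.-1.

Definition decomposable_error (R : realType) (n M : nat)
    (psi : seat_vector n -> R) (phi : 'I_n -> nat -> R) : Prop :=
  [/\ forall m : seat_vector n,
        allocations M m -> psi m = \sum_(j < n) phi j (m j),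
      forall (j : 'I_n) (x : nat), 0 <= phi j x &
      forall (j : 'I_n) (l : nat), (1 <= l)%N ->
        increment phi j l <= increment phi j l.+1].

(* Multisets are represented by sequences up to [perm_eq]. *)
Definition increment_matrix (R : realType) (n M : nat)
    (phi : 'I_n -> nat -> R) : seq R :=
  [seq increment phi j l | j <- enum 'I_n, l <- iota 1 M].

Definition selected_increments (R : realType) (n : nat)
    (phi : 'I_n -> nat -> R) (m : seat_vector n) : seq R :=
  [seq increment phi j l | j <- enum 'I_n, l <- iota 1 (m j)].

Definition minimal_solution (R : realType) (n M : nat)
    (phi : 'I_n -> nat -> R) : set (seat_vector n) :=
  [set m : seat_vector n | allocations M m /\
     perm_eq (selected_increments phi m)
             (take M (sort <=%R (increment_matrix M phi)))]%classic.

Section Rounding.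
Variables (R : realType) (n M : nat) (q : 'I_n -> R) (rho : R).

Definition rho_quota (j : 'I_n) : R :=
  q j / M%:R * (M%:R + 2 * rho - 1).

Definition rho_floor (j : 'I_n) : int := Num.floor (rho_quota j).

Definition rho_remainder (j : 'I_n) : R := rho_quota j - (rho_floor j)%:~R.

Definition residual_seats : int := M%:Z - \sum_(j < n) rho_floor j.

Definition gives_residual_seats (m : seat_vector n) : Prop :=
  exists J : {set 'I_n},
    [/\ #|J|%:Z = residual_seats,
        forall j k : 'I_n, j \in J -> k \notin J ->
          rho_remainder k <= rho_remainder j &
        forall j : 'I_n, (m j)%:Z = rho_floor j + (j \in J)%:Z].

Definition takes_back_seat (m : seat_vector n) : Prop :=
  exists k : 'I_n,
    q k < (rho_floor k)%:~R /\
    forall j : 'I_n, (m j)%:Z = rho_floor j - (j == k)%:Z.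

Definition rho_rounding : set (seat_vector n) :=
  [set m : seat_vector n |
     (0 <= residual_seats /\ gives_residual_seats m) \/
     (residual_seats = -1 /\ takes_back_seat m)]%classic.

End Rounding.

(* Main.v *)
(* The column of the matrix belonging to a party of adjusted quota x, with
   mu = floor x and r = x - mu, reads -1 (mu times), then 1 - 2r, then 1 forever.
   Since columns increase, the M smallest entries are selected exactly when no
   last selected entry of a column exceeds the first unselected entry of
   another. The sum of the remainders is residual + 2 rho - 1. If the residual is
   nonnegative, this forces every party to get mu or mu + 1 seats, the extra ones
   going to the smallest 1 - 2r; otherwise the residual is -1, all remainders
   vanish, and one entry -1 is left out. *)

Require Import Defs.
From mathcomp Require Import all_boot all_order all_algebra.
From mathcomp Require Import boolp classical_sets reals.
From mathcomp Require Import lra zify.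

Import Order.TTheory GRing.Theory Num.Theory.
Local Open Scope ring_scope.

(** * Multisets of smallest entries *)

Lemma perm_allpairs_cat (S T V : eqType) (f : S -> T -> V) (s : seq S)
    (t1 t2 : S -> seq T) :
  perm_eq [seq f x y | x <- s, y <- t1 x ++ t2 x]
          ([seq f x y | x <- s, y <- t1 x] ++ [seq f x y | x <- s, y <- t2 x]).
Proof.
elim: s => //= x s IHs.
by rewrite map_cat -!catA perm_cat2l perm_sym perm_catCA perm_cat2l perm_sym.
Qed.

(** If [a] is the initial segment of the sorted [s], cancellation makes [b] the rest, and sortedness
    separates them. Conversely, if [a] lies below [b], then [sort a ++ sort b] is sorted, so it is
    [sort s] by uniqueness. *)
Lemma perm_take_sort (d : Order.disp_t) (T : orderType d) (s a b : seq T) :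
  perm_eq s (a ++ b) ->
  perm_eq a (take (size a) (sort <=%O s)) = allrel <=%O a b.
Proof.
move=> sab; have sortedS := sort_le_sorted s; apply/idP/idP => [aT|le_ab].
  have bD : perm_eq b (drop (size a) (sort <=%O s)).
    rewrite -(perm_cat2l a) -(permPl sab) -(permPl (permEl (perm_sort <=%O s))).
    by rewrite -[X in perm_eq X _](cat_take_drop (size a)) perm_cat2r perm_sym.
  move: sortedS; rewrite le_sorted_pairwise -[sort _ _](cat_take_drop (size a)).
  rewrite pairwise_cat => /andP[/allrelP le_TD _].
  by apply/allrelP => x y xa yb; apply: le_TD; rewrite -?(perm_mem aT) -?(perm_mem bD).
suff -> : sort <=%O s = sort <=%O a ++ sort <=%O b.
  by rewrite -(size_sort <=%O a) take_size_cat // perm_sym perm_sort.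
apply: le_sorted_eq => //; last first.
  by rewrite perm_sort (permPl sab) perm_cat // perm_sym perm_sort.
rewrite le_sorted_pairwise pairwise_cat -!le_sorted_pairwise !sort_le_sorted !andbT.
apply/allrelP => x y; rewrite !mem_sort; exact: (allrelP le_ab).
Qed.

(** * MinimalSolution as an exchange condition *)

Section MinimalSolution.
Variables (R : realType) (n M : nat) (phi : 'I_n -> nat -> R).

Definition unselected_increments (m : seat_vector n) : seq R :=
  [seq increment phi j l | j <- enum 'I_n, l <- iota (m j).+1 (M - m j)].

Lemma allocation_le (m : seat_vector n) j : allocations M m -> (m j <= M)%N.
Proof. by rewrite /allocations /= => <-; rewrite (bigD1 j) //= leq_addr. Qed.

Lemma allocation_lt (m : seat_vector n) j k :
  allocations M m -> j != k -> (0 < m j)%N -> (m k < M)%N.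
Proof.
rewrite /allocations /= => <- neq_jk m_gt0.
by rewrite (bigD1 k) //= (bigD1 j) //=; lia.
Qed.

Lemma size_selected (m : seat_vector n) :
  allocations M m -> size (selected_increments phi m) = M.
Proof.
rewrite /allocations /= => sum_m.
rewrite size_allpairs_dep sumnE big_map big_enum /= -[RHS]sum_m.
by apply: eq_bigr => j _; rewrite size_iota.
Qed.

Lemma perm_increment_matrix (m : seat_vector n) : allocations M m ->
  perm_eq (increment_matrix M phi)
          (selected_increments phi m ++ unselected_increments m).
Proof.
move=> allm; apply: perm_trans (perm_allpairs_cat _ _ _ _ _ _ _).
rewrite /increment_matrix (@eq_allpairsr _ _ _ _ _ _
  (fun j => iota 1 (m j) ++ iota (m j).+1 (M - m j))) // => j.
by rewrite -[X in iota 1 X](subnKC (allocation_le _ j allm)) iotaD add1n.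
Qed.

Hypothesis increment_le : forall (j : 'I_n) (l : nat), (1 <= l)%N ->
  increment phi j l <= increment phi j l.+1.

Lemma increment_homo j k l : (0 < k)%N -> (k <= l)%N ->
  increment phi j k <= increment phi j l.
Proof.
move=> k_gt0 /subnK <-; elim: (l - k)%N => //= d IHd.
by apply: (le_trans IHd); rewrite addSn increment_le // addn_gt0 k_gt0 orbT.
Qed.

(** As columns increase, the last selected and the first unselected entry of each column decide all
    comparisons. *)
Lemma minimal_solutionP (m : seat_vector n) : allocations M m ->
  minimal_solution M phi m <->
  forall j k, (0 < m j)%N -> increment phi j (m j) <= increment phi k (m k).+1.
Proof.
move=> allm; rewrite /minimal_solution /=.
have := @perm_take_sort _ _ _ _ _ (perm_increment_matrix _ allm).
rewrite size_selected // => ->; split=> [[_ /allrelP le_su] j k m_gt0|le_m].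
  (* For [j = k] the row [(m j).+1] is outside the matrix when [m j = M], so monotonicity is used
     instead. For [j != k] the seat held by [j] leaves [m k < M]. *)
  have [<-|neq_jk] := eqVneq j k; first exact: increment_le.
  have mk_lt := allocation_lt _ _ _ allm neq_jk m_gt0.
  apply: le_su; apply/allpairsPdep.
    by exists j, (m j); rewrite mem_enum mem_iota; split=> //; lia.
  by exists k, (m k).+1; rewrite mem_enum mem_iota; split=> //; lia.
split=> //; apply/allrelP => a b.
move=> /allpairsPdep[j [l [_ l_m ->]]] /allpairsPdep[k [l' [_ l'_m ->]]].
move: l_m l'_m; rewrite !mem_iota => l_m l'_m.
apply: (@le_trans _ _ (increment phi k (m k).+1)); last by apply: increment_homo; lia.
by apply: (@le_trans _ _ (increment phi j (m j))); [apply: increment_homo|apply: le_m]; lia.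
Qed.

End MinimalSolution.

(** * Increments of the distance to a real quota *)

Section AbsIncrement.
Variable R : realType.
Implicit Types (x : R) (l : nat).

(** At the adjusted quota of [j] this is convertible to [increment phi j] for the [phi] of the
    theorem. *)
Definition abs_increment x l : R := `|l%:R - x| - `|l.-1%:R - x|.

Lemma abs_incrementS x l : abs_increment x l.+1 = `|l%:R + 1 - x| - `|l%:R - x|.
Proof. by rewrite /abs_increment /= -natr1. Qed.

Lemma abs_increment_bounds x l : (0 < l)%N -> -1 <= abs_increment x l <= 1.
Proof.
case: l => // l _; rewrite abs_incrementS.
by case: (ger0P (l%:R + 1 - x)); case: (ger0P (l%:R - x)) => *; apply/andP; split; lra.
Qed.

Lemma abs_increment_low x l : (0 < l)%N -> l%:R <= x -> abs_increment x l = -1.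
Proof.
case: l => // l _; rewrite abs_incrementS -natr1 => le_lx.
by rewrite !ler0_norm; lra.
Qed.

Lemma abs_increment_high x l : x <= l%:R -> abs_increment x l.+1 = 1.
Proof. by move=> le_xl; rewrite abs_incrementS !ger0_norm; lra. Qed.

Lemma abs_increment_mid x l :
  l%:R <= x <= l.+1%:R -> abs_increment x l.+1 = 1 - 2 * (x - l%:R).
Proof.
rewrite abs_incrementS -natr1 => /andP[lx xl].
by rewrite ger0_norm ?ler0_norm; lra.
Qed.

(** This is the convexity of the absolute value. *)
Lemma abs_increment_le x l :
  (0 < l)%N -> abs_increment x l <= abs_increment x l.+1.
Proof.
case: l => // l _; rewrite !abs_incrementS -!natr1.
by case: (ger0P (l%:R + 1 - x)); case: (ger0P (l%:R - x));
  case: (ger0P (l%:R + 1 + 1 - x)) => *; lra.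
Qed.

End AbsIncrement.

Arguments abs_increment {R}.

(** * The exchange condition characterizes the rounding method *)

Section Rounding.
Variables (R : realType) (n M : nat) (q : 'I_n -> R) (rho : R).
Hypotheses (M_gt0 : (0 < M)%N) (q_ge0 : forall j : 'I_n, 0 <= q j).
Hypotheses (sum_q : \sum_(j < n) q j = M%:R) (rho_ge0 : 0 <= rho) (rho_le1 : rho <= 1).

Local Notation x := (rho_quota M q rho).
(** Seats are natural numbers but the floor is an integer; the two agree because adjusted quotas are
    nonnegative. *)
Local Notation mu := (fun j => `|rho_floor M q rho j|%N).
Local Notation residual := (residual_seats M q rho).

Lemma M_ge1 : 1 <= M%:R :> R. Proof. by rewrite ler1n. Qed.

Lemma rho_quota_ge0 j : 0 <= x j.
Proof.
by rewrite mulr_ge0 ?divr_ge0 //; have := M_ge1; move: rho_ge0; lra.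
Qed.

Lemma rho_floorE j : rho_floor M q rho j = (mu j)%:Z.
Proof. by rewrite gez0_abs // floor_ge0 rho_quota_ge0. Qed.

Lemma mu_le j : (mu j)%:R <= x j.
Proof. by rewrite pmulrn -rho_floorE; exact: floor_le. Qed.

Lemma mu_gt j : x j < (mu j).+1%:R.
Proof.
by rewrite -natr1 [X in X + 1]pmulrn -rho_floorE -(intrD _ _ 1) floorD1_gt.
Qed.

Lemma rho_remainderE j : rho_remainder M q rho j = x j - (mu j)%:R.
Proof. by rewrite /rho_remainder rho_floorE pmulrn. Qed.

Lemma sum_rho_quota : \sum_(j < n) x j = M%:R + 2 * rho - 1.
Proof.
have M0 : M%:R != 0 :> R by rewrite pnatr_eq0 -lt0n.
by rewrite -!mulr_suml sum_q divff // mul1r.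
Qed.

Lemma residualE : residual = M%:Z - (\sum_(j < n) mu j)%N%:Z.
Proof.
rewrite /residual_seats (eq_bigr _ (fun j _ => rho_floorE j)); congr (_ - _).
by rewrite -[RHS]natz natr_sum; apply: eq_bigr => j _; rewrite natz.
Qed.

Lemma sum_remainder :
  \sum_(j < n) (x j - (mu j)%:R) = residual%:~R + 2 * rho - 1.
Proof.
rewrite sumrB sum_rho_quota residualE intrB -!pmulrn natr_sum; lra.
Qed.

(** The remainders are nonnegative, hence so is their sum [residual + 2 * rho - 1], where
    [rho <= 1]. *)
Lemma residual_ge : -1 <= residual.
Proof.
rewrite -(ler_int R) rmorphN1.
have : 0 <= \sum_(j < n) (x j - (mu j)%:R).
  by apply: sumr_ge0 => j _; rewrite subr_ge0 mu_le.
rewrite sum_remainder; move: rho_le1; lra.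
Qed.

(** The remainders now sum to [2 * rho - 2 <= 0]; being nonnegative, they all vanish and
    [rho = 1]. *)
Lemma residual_neg : residual = -1 -> rho = 1 /\ forall j, x j = (mu j)%:R.
Proof.
move=> res; have := sum_remainder; rewrite res rmorphN1 => sum_r.
have r_ge0 j : 0 <= x j - (mu j)%:R by rewrite subr_ge0 mu_le.
have : 0 <= \sum_(j < n) (x j - (mu j)%:R) by apply: sumr_ge0.
rewrite sum_r => sum_ge0.
have rho1 : rho = 1 by move: rho_le1; lra.
split=> // j; apply: subr0_eq.
apply: (@psumr_eq0P _ _ predT (fun j => x j - (mu j)%:R)) => //.
by rewrite sum_r rho1; lra.
Qed.

(** For [j != k]: moving one seat from [j] to [k] does not lower the error. *)
Definition exchange_optimal (m : seat_vector n) :=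
  forall j k, (0 < m j)%N ->
    abs_increment (x j) (m j) <= abs_increment (x k) (m k).+1.

(** Since [r < 1] strictly, [1 - 2 * r > -1]; so the entries -1 of column [j] are exactly the first
    [mu j]. *)
Lemma abs_increment_gtN1 j l : (mu j < l)%N -> -1 < abs_increment (x j) l.
Proof.
case: l => // l; rewrite ltnS leq_eqVlt => /orP[/eqP <-|lt_l].
  have := mu_le j; have := mu_gt j => h1 h2.
  by rewrite abs_increment_mid ?h2 ?ltW //; move: h1; rewrite -natr1; lra.
rewrite abs_increment_high; first lra.
by apply: le_trans (ltW (mu_gt j)) _; rewrite ler_nat.
Qed.

Lemma abs_increment_le_mu j l : (0 < l <= mu j)%N -> abs_increment (x j) l = -1.
Proof.
move=> /andP[l0 lmu]; apply: abs_increment_low => //.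
by apply: le_trans (mu_le j); rewrite ler_nat.
Qed.

Lemma abs_increment_mu j :
  abs_increment (x j) (mu j).+1 = 1 - 2 * rho_remainder M q rho j.
Proof. by rewrite abs_increment_mid ?mu_le ?(ltW (mu_gt j)) // rho_remainderE. Qed.

Lemma abs_increment_gt_mu j l :
  ((mu j).+1 < l)%N -> abs_increment (x j) l = 1.
Proof.
case: l => // l lt_l; apply: abs_increment_high.
by apply: le_trans (ltW (mu_gt j)) _; rewrite ler_nat.
Qed.

Lemma sum_lt (a b : 'I_n -> nat) k : (forall j, a j <= b j)%N ->
  (a k < b k)%N -> (\sum_(j < n) a j < \sum_(j < n) b j)%N.
Proof.
move=> le_ab lt_k; rewrite (bigD1 k) //= [X in (_ < X)%N](bigD1 k) //=.
by rewrite -addSn leq_add // leq_sum.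
Qed.

Lemma sum_add_mem (a b : 'I_n -> nat) (J : {set 'I_n}) :
  (forall j, b j = a j + (j \in J))%N ->
  (\sum_(j < n) b j = \sum_(j < n) a j + #|J|)%N.
Proof.
move=> bE; rewrite (eq_bigr _ (fun j _ => bE j)) big_split /= -sum1_card.
by congr (_ + _)%N; rewrite [RHS]big_mkcond /=; apply: eq_bigr => j _; case: (j \in J).
Qed.

(* If [m k < mu k], some unselected entry is -1, hence all selected ones are. *)
Lemma exchange_optimal_mu (m : seat_vector n) : exchange_optimal m ->
  (forall j, mu j <= m j)%N \/ (forall j, m j <= mu j)%N.
Proof.
move=> opt; have [/forallP|] := boolP [forall j, mu j <= m j]%N; first by left.
rewrite negb_forall => /existsP[k]; rewrite -ltnNge => lt_k; right=> j.
rewrite leqNgt; apply/negP => lt_j.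
have := opt j k (leq_ltn_trans (leq0n _) lt_j).
by rewrite (abs_increment_le_mu k) // leNgt abs_increment_gtN1.
Qed.

(* If [m j >= mu j + 2], the selected entry 1 forces every other unselected entry
   to be 1, hence [x k <= m k] for all [k]; as [x j + 1 < m j], this gives
   [\sum_k x k + 1 < M], whereas [\sum_k x k = M + 2 * rho - 1]. *)
Lemma exchange_optimal_leS (m : seat_vector n) j : allocations M m ->
  exchange_optimal m -> (forall k, mu k <= m k)%N -> (m j <= (mu j).+1)%N.
Proof.
move=> allm opt le_m; rewrite leqNgt; apply/negP => lt_j.
have excess k : x k <= (m k)%:R.
  rewrite leNgt; apply/negP => lt_k.
  have := opt j k (leq_ltn_trans (leq0n _) lt_j).
  rewrite abs_increment_gt_mu // abs_increment_mid.
    move: lt_k; lra.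
  rewrite (ltW lt_k) (le_trans (ltW (mu_gt k))) // ler_nat ltnS; exact: le_m.
have : \sum_k x k + 1 < \sum_k (m k)%:R.
  rewrite (bigD1 j) //= [X in _ < X](bigD1 j) //= addrAC ltr_leD //.
    apply: (@lt_le_trans _ _ ((mu j).+2%:R)); last by rewrite ler_nat.
    by have := mu_gt j; rewrite -!natr1; lra.
  exact: ler_sum.
by rewrite -natr_sum allm sum_rho_quota; move: rho_ge0; lra.
Qed.

Lemma exchange_optimal_gives (m : seat_vector n) : allocations M m ->
  0 <= residual -> exchange_optimal m -> gives_residual_seats M q rho m.
Proof.
move=> allm; rewrite residualE => res opt.
(* Otherwise [m <= mu] everywhere, strictly at [j], and the seats sum to less than [M]. *)
have le_m j : (mu j <= m j)%N.
  case: (exchange_optimal_mu m opt) => // ge_m; rewrite leqNgt; apply/negP => lt_j.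
  by have := sum_lt _ _ j ge_m lt_j; rewrite allm; move: res; lia.
have m_le j := exchange_optimal_leS _ j allm opt le_m.
pose J := [set j | (mu j < m j)%N].
have mE j : m j = (mu j + (j \in J))%N.
  by rewrite inE; have := le_m j; have := m_le j; lia.
exists J; split=> [|j k jJ kJ|j]; last by rewrite rho_floorE mE PoszD.
- by move: allm; rewrite residualE /allocations /= (sum_add_mem _ _ _ mE) /=; lia.
- have := opt j k; rewrite !mE jJ (negbTE kJ) addn1 addn0 => /(_ isT).
  rewrite !abs_increment_mu; lra.
Qed.

Lemma exchange_optimal_takes (m : seat_vector n) : allocations M m ->
  residual = -1 -> exchange_optimal m -> takes_back_seat M q rho m.
Proof.
move=> allm res opt; have [rho1 xE] := residual_neg res.
move: res; rewrite residualE => res.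
(* Here [mu] sums to [M + 1], so it cannot lie below [m] everywhere. *)
have m_le j : (m j <= mu j)%N.
  case: (exchange_optimal_mu m opt) => // ge_m.
  have : (\sum_(j < n) mu j <= \sum_(j < n) m j)%N by apply: leq_sum => i _; exact: ge_m.
  by rewrite allm; move: res; lia.
have [k lt_k] : exists k, (m k < mu k)%N.
  apply/existsP; rewrite -[X in is_true X]negbK negb_exists; apply/negP => /forallP ge_m.
  have : (\sum_(j < n) mu j <= \sum_(j < n) m j)%N.
    by apply: leq_sum => i _; rewrite leqNgt ge_m.
  by rewrite allm; move: res; lia.
(* Returning one seat to [k] brings the total to [M + 1], the sum of [mu], so no further deficit is
   possible. *)
have m_ge j : (mu j <= m j + (j \in [set k]))%N.
  rewrite leqNgt; apply/negP => lt_j.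
  have le_mk i : (m i + (i \in [set k]) <= mu i)%N.
    by have := m_le i; rewrite inE; case: eqVneq => [->|_]; lia.
  have := sum_lt _ _ j le_mk lt_j.
  by rewrite (sum_add_mem m _ [set k]) // cards1 allm; move: res; lia.
exists k; split; last first.
  move=> j; rewrite rho_floorE; have := m_le j; have := m_ge j.
  by rewrite inE; case: eqVneq => [->|_]; lia.
(* With [rho = 1], [x k = q k + q k / M]. This exceeds [q k] unless [q k = 0], which would give
   [x k = 0], against [0 <= m k < mu k]. *)
rewrite rho_floorE -pmulrn -xE.
have : 0 < x k by rewrite xE ltr0n (leq_ltn_trans _ lt_k).
have M1 := M_ge1; have Mp : 0 < M%:R :> R by lra.
rewrite /rho_quota rho1 (_ : _ - 1 = M%:R + 1); last by lra.
rewrite mulrDr mulfVK ?gt_eqF // mulr1 => x_gt0.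
rewrite ltrDl divr_gt0 // lt_neqAle q_ge0 andbT; apply/eqP => q0.
by move: x_gt0; rewrite -q0 mul0r addr0 ltxx.
Qed.

(** If [j] is outside [J], its last selected entry is -1, the minimum. If [j] and [k] are both in
    [J], the first unselected entry of [k] is 1, the maximum. The remaining case is the order of the
    remainders. *)
Lemma gives_residual_seats_optimal (m : seat_vector n) :
  gives_residual_seats M q rho m -> allocations M m /\ exchange_optimal m.
Proof.
case=> J [cardJ remJ mJ].
have mE j : m j = (mu j + (j \in J))%N by have := mJ j; rewrite rho_floorE; lia.
split.
  by move: cardJ; rewrite residualE /allocations /= (sum_add_mem _ _ _ mE) /=; lia.
move=> j k; rewrite !mE; have [jJ _|jJ] := boolP (j \in J); last first.
  rewrite addn0 => mu0; rewrite abs_increment_le_mu ?mu0 ?leqnn //.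
  by case/andP: (abs_increment_bounds _ (x k) _ (ltn0Sn (mu k + (k \in J)))).
have [kJ|kJ] := boolP (k \in J).
  rewrite !addn1 (abs_increment_gt_mu k) //.
  by case/andP: (abs_increment_bounds _ (x j) _ (ltn0Sn (mu j))).
by rewrite addn1 addn0 !abs_increment_mu; have := remJ _ _ jJ kJ; lra.
Qed.

(** Every selected entry is -1, the least possible value. *)
Lemma takes_back_seat_optimal (m : seat_vector n) : residual = -1 ->
  takes_back_seat M q rho m -> allocations M m /\ exchange_optimal m.
Proof.
rewrite residualE => res [k [_ mk]].
have mE j : mu j = (m j + (j \in [set k]))%N.
  by have := mk j; rewrite inE rho_floorE; case: eqVneq => [->|_]; lia.
split.
  by move: res; rewrite /allocations /= (sum_add_mem _ _ _ mE) cards1 /=; lia.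
move=> j i m_gt0; rewrite abs_increment_le_mu ?m_gt0 ?mE ?leq_addr //.
by case/andP: (abs_increment_bounds _ (x i) _ (ltn0Sn (m i))).
Qed.

Lemma rho_roundingP (m : seat_vector n) :
  rho_rounding M q rho m <-> allocations M m /\ exchange_optimal m.
Proof.
rewrite /rho_rounding /=; split=> [[[_ giv]|[res tak]]|[allm opt]].
- exact: gives_residual_seats_optimal.
- exact: takes_back_seat_optimal.
have [res|res] := leP 0 residual; first by left; split=> //; apply: exchange_optimal_gives.
have res1 : residual = -1 by have := residual_ge; lia.
by right; split=> //; apply: exchange_optimal_takes.
Qed.

End Rounding.

Theorem corollary6p5 (R : realType) (n M : nat) (q : 'I_n -> R) (rho : R)
    (n_gt0 : (0 < n)%N) (M_gt0 : (0 < M)%N)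
    (q_ge0 : forall j : 'I_n, 0 <= q j)
    (sum_q : \sum_(j < n) q j = M%:R)
    (rho_ge0 : 0 <= rho) (rho_le1 : rho <= 1) :
  let phi := fun (j : 'I_n) (x : nat) => `|x%:R - rho_quota M q rho j| in
  let psi := fun m : seat_vector n =>
    \sum_(j < n) `|(m j)%:R - rho_quota M q rho j| in
  decomposable_error M psi phi /\
  minimal_solution M phi = rho_rounding M q rho.
Proof.
move=> phi psi.
have phi_le (j : 'I_n) l : (1 <= l)%N -> increment phi j l <= increment phi j l.+1.
  exact: abs_increment_le.
split; first by split=> // j l; exact: normr_ge0.
rewrite predeqE => m.
rewrite (rho_roundingP _ _ _ _ _ M_gt0 q_ge0 sum_q rho_ge0 rho_le1); split.
  move=> minm; have [allm _] := minm; split=> //.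
  exact: (minimal_solutionP _ _ _ _ phi_le _ allm).1 minm.
case=> allm opt; exact: (minimal_solutionP _ _ _ _ phi_le _ allm).2 opt.
Qed.
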